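(* Let $d\geq1$, let $\alpha_1,\ldots,\alpha_d>0$ with $2\sum_{i=1}^d\alpha_i=1$, let $0<c<\min\{\alpha_1,\ldots,\alpha_d\}$, and let $M\geq0$ be an integer. For each $i$ let $\tilde\alpha_i,\tilde\beta_i:\mathbb{Z}\to[c,\infty)$ satisfy $\tilde\alpha_i(x)+\tilde\beta_i(x)\leq2\alpha_i$ and $\tilde\alpha_i(x)=\tilde\beta_i(-x)$ for all $x\in\mathbb{Z}$, and $\tilde\alpha_i(x)=\tilde\beta_i(x)=\alpha_i$ whenever $|x|>M$. Let $\mathbf{S}_t$ be the random walk in $\mathbb{Z}^d$ with $\mathbf{S}_0=\mathbf{0}$, $\mathbf{S}_t=\mathbf{S}_{t-1}+\mathbf{e}_t$, where, given the past, $\mathbf{e}_t=\mathbf{1}_i$ with probability $\tilde\alpha_i(S^{(i)}_{t-1})$, $\mathbf{e}_t=-\mathbf{1}_i$ with probability $\tilde\beta_i(S^{(i)}_{t-1})$ ($i=1,\ldots,d$), and $\mathbf{e}_t=\mathbf{0}$ with probability $1-\sum_{i=1}^d[\tilde\alpha_i(S^{(i)}_{t-1})+\tilde\beta_i(S^{(i)}_{t-1})]$. Then $\mathbf{S}_t$ is recurrent if $d\leq2$ and transient if $d\geq3$.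
   Context: $\mathbf{1}_i$ is the $i$th unit vector of $\mathbb{Z}^d$ and $S^{(i)}_t$ the $i$th coordinate of $\mathbf{S}_t$. Recurrent means that the walk returns to the origin infinitely many times with probability one; transient means it is not recurrent. *)

(* Defs.v *)
From HB Require Import structures.
From mathcomp Require Import all_boot all_order all_algebra.
From mathcomp Require Import all_classical all_reals all_analysis.
Set Implicit Arguments. Unset Strict Implicit. Unset Printing Implicit Defensive.
Import Order.TTheory GRing.Theory Num.Theory.
Local Open Scope classical_set_scope.
Local Open Scope ring_scope.

Definition step_prob (R : realType) (d : nat) (ta tb : 'I_d -> int -> R)
  (s s' : 'rV[int]_d) : R :=
  \sum_(i < d) (ta i (s ord0 i) * (s' == s + delta_mx ord0 i)%:R
              + tb i (s ord0 i) * (s' == s - delta_mx ord0 i)%:R)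
  + (1 - \sum_(i < d) (ta i (s ord0 i) + tb i (s ord0 i))) * (s' == s)%:R.

Definition recurrent (R : realType) (dT : measure_display) (T : measurableType dT)
  (P : probability T R) (d : nat) (S : nat -> T -> 'rV[int]_d) : Prop :=
  P [set w | forall n : nat, exists2 t : nat, (n <= t)%N & S t w = 0] = 1%E.

Definition transient (R : realType) (dT : measure_display) (T : measurableType dT)
  (P : probability T R) (d : nat) (S : nat -> T -> 'rV[int]_d) : Prop :=
  ~ recurrent P S.

(* Main.v *)
Require Import Defs.
From HB Require Import structures.
From mathcomp Require Import all_boot all_order all_algebra.
From mathcomp Require Import all_classical all_reals all_analysis.
From mathcomp Require Import zify ring lra.
Import Order.TTheory GRing.Theory Num.Theory.
Local Open Scope classical_set_scope.
Local Open Scope ring_scope.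

(* The symmetry [ta i x = tb i (- x)] makes the walk reversible with respect to a product
   measure, so it is a random walk on the lattice with conductances, and these are bounded
   above and below because the perturbation of each coordinate lives on [-M, M].

   Let [g N] be the expected number of visits before time [N], divided by the reversing
   measure. Its Dirichlet energy is at most [g N 0]. If [d >= 3], the flow of Polya's urn on
   an octant is a unit flow from the origin to infinity with finite energy; hence
   [f 0 <= 2 mu + C * energy f / mu] for all finitely supported [f] and [mu > 0], which
   applied to [f = g N] bounds [g N 0], and Borel-Cantelli gives transience. If [d <= 2],
   there are finitely supported functions equal to 1 at the origin of arbitrarily small
   energy (logarithmic potentials), which is incompatible with [g N 0] being bounded;
   decomposing according to the last visit to the origin then gives recurrence. *)

(** * The lattice and its reversible network *)

(** Makes lattice sums independent of the finite window, as soon as both windows contain the same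
    points of the support. *)
Lemma eq_big_support (V : zmodType) (I : eqType) (F : I -> V) (s1 s2 : seq I) :
  uniq s1 -> uniq s2 -> (forall x, F x != 0 -> (x \in s1) = (x \in s2)) ->
  \sum_(x <- s1) F x = \sum_(x <- s2) F x.
Proof.
move=> u1 u2 s12.
have supp s : \sum_(x <- s) F x = \sum_(x <- [seq x <- s | F x != 0]) F x.
  by rewrite big_filter [RHS]big_mkcond; apply: eq_bigr => x _; case: eqVneq.
rewrite (supp s1) (supp s2); apply: perm_big; apply: uniq_perm.
- exact: filter_uniq.
- exact: filter_uniq.
by move=> x; rewrite !mem_filter; case: eqVneq => //= /s12.
Qed.

Lemma big_shift (V W : zmodType) (F : W -> V) (s : seq W) (e : W) :
  uniq s -> (forall x, F x != 0 -> (x \in s) /\ (x - e \in s)) ->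
  \sum_(x <- s) F (x + e) = \sum_(x <- s) F x.
Proof.
move=> us Fs; rewrite -(big_map (fun x => x + e) predT F).
apply: eq_big_support => // [|x /Fs[xs xes]].
  by rewrite map_inj_uniq//; exact: addIr.
by rewrite xs -[x](subrK e) (mem_map (addIr e)).
Qed.

Lemma big_indicator (R : pzRingType) (I : eqType) (F : I -> R) (s : seq I) (y : I) :
  uniq s -> (F y != 0 -> y \in s) -> \sum_(x <- s) F x * (x == y)%:R = F y.
Proof.
move=> us Fs; have -> : \sum_(x <- s) F x * (x == y)%:R =
    \sum_(x <- [:: y]) F x * (x == y)%:R.
  apply: eq_big_support => // x; have [->|] := eqVneq x y; last by rewrite mulr0 eqxx.
  by rewrite mulr1 => /Fs ->; rewrite inE eqxx.
by rewrite big_seq1 eqxx mulr1.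
Qed.

Lemma ler_sum_seq_subset (R : numDomainType) (I : eqType) (F : I -> R) (s1 s2 : seq I) :
  uniq s1 -> uniq s2 -> {subset s1 <= s2} -> (forall x, 0 <= F x) ->
  \sum_(x <- s1) F x <= \sum_(x <- s2) F x.
Proof.
move=> u1 u2 s12 F0; rewrite [leRHS](bigID (mem s1) predT)/= -[leLHS]addr0 lerD//.
  rewrite -(big_filter s2) le_eqVlt; apply/orP; left; apply/eqP; apply: perm_big; apply: uniq_perm => //.
    exact: filter_uniq.
  by move=> x; rewrite mem_filter; case: (boolP (x \in s1)) => //= /s12 ->.
by apply: sumr_ge0.
Qed.

Section lattice.
Variable d : nat.
Implicit Types x : 'rV[int]_d.

Definition supnorm x : nat := \max_(i < d) `|x ord0 i|%N.

Definition box (k : nat) : seq 'rV[int]_d :=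
  undup [seq \row_i ((f i)%:Z - k%:Z) | f : {ffun 'I_d -> 'I_(2 * k).+1}].

Lemma supnormP x k : reflect (forall i, (`|x ord0 i| <= k)%N) (supnorm x <= k)%N.
Proof. by apply: (iffP (bigmax_leqP _ _ _)) => h i; [exact: h|move=> _; exact: h]. Qed.

Lemma mem_box x k : (x \in box k) = (supnorm x <= k)%N.
Proof.
rewrite mem_undup; apply/mapP/supnormP => [[f _ ->] i|xk].
  rewrite !mxE; have := ltn_ord (f i); move: (nat_of_ord (f i)) => a; lia.
have bd i : (`|(x ord0 i + k%:Z)%R| < (2 * k).+1)%N by have := xk i; lia.
exists [ffun i => Ordinal (bd i)]; first by rewrite mem_enum.
apply/rowP => i; rewrite !mxE ffunE /=; move: (xk i); move: (x ord0 i) => y.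
by lia.
Qed.

Lemma box_uniq k : uniq (box k).
Proof. exact: undup_uniq. Qed.

Lemma size_box k : (size (box k) <= (2 * k).+1 ^ d)%N.
Proof.
apply: leq_trans (size_undup _) _.
by rewrite size_map -cardE card_ffun !card_ord.
Qed.

Lemma supnorm0 : supnorm 0 = 0%N.
Proof. by apply/eqP; rewrite -leqn0; apply/supnormP => i; rewrite mxE. Qed.

Lemma supnormD x i : (supnorm (x + delta_mx ord0 i) <= (supnorm x).+1)%N.
Proof.
apply/supnormP => j; have /supnormP/(_ j) := leqnn (supnorm x).
by rewrite !mxE /=; case: (j == i); lia.
Qed.

Lemma supnormB x i : (supnorm (x - delta_mx ord0 i) <= (supnorm x).+1)%N.
Proof.
apply/supnormP => j; have /supnormP/(_ j) := leqnn (supnorm x).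
by rewrite !mxE /=; case: (j == i); lia.
Qed.

End lattice.

Section network.
Variables (R : realType) (d : nat) (ta tb : 'I_d -> int -> R).
Implicit Types (f g : 'rV[int]_d -> R) (x : 'rV[int]_d).

(* By [tab_sym] the reversing measure of each coordinate is even, so it depends on
   [`|y|] only; detailed balance forces these increments. *)
Definition radial_weight (i : 'I_d) (n : nat) : R :=
  \prod_(k < n) (ta i k%:Z / tb i k.+1%:Z).

Definition reversing x : R := \prod_(i < d) radial_weight i `|x ord0 i|%N.

Definition conductance (i : 'I_d) x : R := reversing x * ta i (x ord0 i).

Definition transition f x : R :=
  \sum_(i < d) (ta i (x ord0 i) * f (x + delta_mx ord0 i)
              + tb i (x ord0 i) * f (x - delta_mx ord0 i))
  + (1 - \sum_(i < d) (ta i (x ord0 i) + tb i (x ord0 i))) * f x.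

(* Sums over the lattice are taken over a finite window [s]; the identities below
   hold once [s] strictly contains the support of one of the two functions. *)
Definition dirichlet_form (s : seq 'rV[int]_d) f g : R :=
  \sum_(x <- s) \sum_(i < d) conductance i x
    * (f (x + delta_mx ord0 i) - f x) * (g (x + delta_mx ord0 i) - g x).

Definition weighted_inner (s : seq 'rV[int]_d) f g : R :=
  \sum_(x <- s) reversing x * f x * g x.

Lemma dirichlet_formC s f g : dirichlet_form s f g = dirichlet_form s g f.
Proof. by apply: eq_bigr => x _; apply: eq_bigr => i _; ring. Qed.

Lemma weighted_innerC s f g : weighted_inner s f g = weighted_inner s g f.
Proof. by apply: eq_bigr => x _; ring. Qed.

Hypothesis ta_gt0 : forall i y, 0 < ta i y.
Hypothesis tb_gt0 : forall i y, 0 < tb i y.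
Hypothesis tab_sym : forall i y, ta i y = tb i (- y).

Lemma radial_weight_gt0 i n : 0 < radial_weight i n.
Proof. by apply: prodr_gt0 => k _; rewrite divr_gt0. Qed.

Lemma reversing_gt0 x : 0 < reversing x.
Proof. by apply: prodr_gt0 => i _; exact: radial_weight_gt0. Qed.

Lemma reversing0 : reversing 0 = 1.
Proof. by apply: big1 => i _; rewrite mxE /radial_weight big_ord0. Qed.

(** For [y >= 0] this is the recursion defining the weight. For negative [y], [tab_sym] exchanges
    [ta] and [tb] and gives the same recursion read backwards. *)
Lemma radial_weight_balance i (y : int) :
  radial_weight i `|y|%N * ta i y = radial_weight i `|(y + 1)%R|%N * tb i (y + 1).
Proof.
have tbN n : tb i n.+1%:Z != 0 by rewrite gt_eqF.
case: y => n.
  have -> : Posz n + 1 = n.+1%:Z by lia.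
  by rewrite !absz_nat /radial_weight big_ord_recr/= -!mulrA mulVf ?mulr1.
have -> : Negz n + 1 = - n%:Z by rewrite NegzE; lia.
rewrite abszN absz_nat NegzE abszN absz_nat -tab_sym (tab_sym i (- n.+1%:Z)) opprK.
by rewrite /radial_weight big_ord_recr/= -!mulrA mulVf ?mulr1.
Qed.

Lemma reversing_balance i x :
  reversing x * ta i (x ord0 i)
  = reversing (x + delta_mx ord0 i) * tb i (x ord0 i + 1).
Proof.
rewrite /reversing (bigD1 i)//= [in RHS](bigD1 i)//= !mxE !eqxx/=.
rewrite mulrAC radial_weight_balance mulrAC; congr (_ * _ * _).
by apply: eq_bigr => j /negPf ji; rewrite !mxE ji andbF addr0.
Qed.

Lemma conductanceB i x :
  conductance i (x - delta_mx ord0 i) = reversing x * tb i (x ord0 i).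
Proof.
rewrite /conductance reversing_balance subrK; congr (_ * tb i _).
by rewrite !mxE !eqxx/= subrK.
Qed.

(** Divergence form of the generator: by [conductanceB] the backward rates, too, are conductances of
    edges at [x]. *)
Lemma reversing_laplacian g x :
  reversing x * (g x - transition g x)
  = \sum_(i < d) (conductance i x * (g x - g (x + delta_mx ord0 i))
      + conductance i (x - delta_mx ord0 i) * (g x - g (x - delta_mx ord0 i))).
Proof.
under eq_bigr do rewrite conductanceB.
rewrite /transition /conductance mulrBl mul1r opprD opprB addrCA.
rewrite [X in _ * (_ + X)](_ : _ = \sum_(i < d) (ta i (x ord0 i) + tb i (x ord0 i)) * g x).
  rewrite addrC -sumrB mulr_sumr; apply: eq_bigr => i _; ring.
by rewrite mulr_suml; ring.
Qed.

(** Summation by parts. Translating the backward terms by one unit vector puts both halves of the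
    Laplacian on the same edge; the window [k.+1] leaves room for this translation. *)
Lemma green_identity k s f g : uniq s -> {subset box d k.+1 <= s} ->
  (forall x, f x != 0 -> (supnorm d x <= k)%N) ->
  weighted_inner s f (fun x => g x - transition g x) = dirichlet_form s f g.
Proof.
move=> us ks fk; rewrite /weighted_inner /dirichlet_form.
under eq_bigr => x _.
  rewrite (mulrC (reversing x)) -mulrA reversing_laplacian big_split mulrDr /= !mulr_sumr.
  over.
rewrite big_split/= exchange_big/=.
rewrite [X in _ + X]exchange_big/= [RHS]exchange_big/= -big_split/=.
apply: eq_bigr => i _.
pose F x := f x * (conductance i (x - delta_mx ord0 i) * (g x - g (x - delta_mx ord0 i))).
have -> : \sum_(x <- s) F x = \sum_(x <- s) F (x + delta_mx ord0 i).
  rewrite big_shift// => x; have [fx|/fk fx _] := eqVneq (f x) 0.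
    by rewrite /F fx mul0r eqxx.
  split; apply: ks; rewrite mem_box; first exact: leqW.
  by apply: leq_trans (supnormB _ _ _) _.
rewrite -big_split/=; apply: eq_bigr => x _.
by rewrite /F addrK; ring.
Qed.


End network.

(** * A unit flow of finite energy on an octant *)

Lemma sum_shift_ord (V : zmodType) (F : nat -> V) (K : nat) :
  F 0%N = 0 -> F K = 0 -> \sum_(k < K) F k.+1 = \sum_(k < K) F k.
Proof.
move=> F0 FK; transitivity (\sum_(k < K.+1) F k).
  by rewrite big_ord_recl F0 add0r.
by rewrite big_ord_recr/= FK addr0.
Qed.

Lemma sum_telescope_le (R : numDomainType) (F G : nat -> R) (K : nat) :
  (forall k, 0 <= F k) -> (forall k, G k <= F k - F k.+1) ->
  \sum_(k < K) G k <= F 0%N.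
Proof.
move=> F0 GF; apply: (@le_trans _ _ (F 0%N - F K)); last first.
  by rewrite gerBl.
elim: K => [|K IH]; first by rewrite big_ord0 subrr.
by rewrite big_ord_recr/=; apply: le_trans (lerD IH (GF K)) _; rewrite addrA subrK.
Qed.

Ltac nonzero := rewrite -?andbA; repeat (apply/andP; split); apply: lt0r_neq0; lra.

Section polya_flow.
Variable R : realFieldType.
Implicit Types phi : nat -> nat -> nat -> R.

(* [polya 0 = 0] because of the division by zero; this is the right value for the flow
   entering the origin. *)
Definition polya (n : nat) : R := 2 / (n%:R * n.+1%:R * n.+2%:R).

Definition octant_sum (K : nat) phi : R :=
  \sum_(a < K) \sum_(b < K) \sum_(c < K) phi a b c.

Lemma octant_sumD K phi psi :
  octant_sum K (fun a b c => phi a b c + psi a b c) = octant_sum K phi + octant_sum K psi.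
Proof.
rewrite /octant_sum -big_split; apply: eq_bigr => a _.
rewrite -big_split; apply: eq_bigr => b _.
by rewrite -big_split.
Qed.

Lemma octant_sumB K phi psi :
  octant_sum K (fun a b c => phi a b c - psi a b c) = octant_sum K phi - octant_sum K psi.
Proof.
rewrite /octant_sum -sumrB; apply: eq_bigr => a _.
rewrite -sumrB; apply: eq_bigr => b _.
by rewrite -sumrB.
Qed.

Lemma octant_sumZ K (r : R) phi :
  octant_sum K (fun a b c => r * phi a b c) = r * octant_sum K phi.
Proof.
rewrite /octant_sum mulr_sumr; apply: eq_bigr => a _.
by rewrite mulr_sumr; apply: eq_bigr => b _; rewrite mulr_sumr.
Qed.

Lemma ler_octant_sum K phi psi :
  (forall a b c, phi a b c <= psi a b c) -> octant_sum K phi <= octant_sum K psi.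
Proof. by move=> h; do 3!(apply: ler_sum => ? _). Qed.

Lemma eq_octant_sum K phi psi :
  (forall a b c, phi a b c = psi a b c) -> octant_sum K phi = octant_sum K psi.
Proof. by move=> h; do 3!(apply: eq_bigr => ? _). Qed.

(* The flow of Polya's urn: the edge from (a,b,c) to (a+1,b,c) carries
   [(a+1) * polya (a+b+c+1)], and the divergence vanishes away from the origin. *)
Lemma polya_flow K phi :
  (forall a b c, (K <= maxn a (maxn b c))%N -> phi a b c = 0) ->
  octant_sum K (fun a b c => polya (a + b + c).+1 *
    (a.+1%:R * (phi a b c - phi a.+1 b c) + b.+1%:R * (phi a b c - phi a b.+1 c)
     + c.+1%:R * (phi a b c - phi a b c.+1))) = phi 0%N 0%N 0%N.
Proof.
move=> phiK.
(* [out] is the total flow leaving a vertex and [psi] the flow entering it along one coordinate,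
   both weighted by [phi]. Reindexing the entering terms loses nothing: they vanish on the face of
   the octant by the factor [x] and at [K] by [phiK]. *)
pose out a b c := polya (a + b + c).+1 * (a + b + c + 3)%:R * phi a b c.
pose psi x a b c := polya (a + b + c) * x%:R * phi a b c.
have -> : octant_sum K (fun a b c => polya (a + b + c).+1 *
    (a.+1%:R * (phi a b c - phi a.+1 b c) + b.+1%:R * (phi a b c - phi a b.+1 c)
     + c.+1%:R * (phi a b c - phi a b c.+1)))
  = octant_sum K out - (octant_sum K (fun a b c => psi a.+1 a.+1 b c)
     + octant_sum K (fun a b c => psi b.+1 a b.+1 c)
     + octant_sum K (fun a b c => psi c.+1 a b c.+1)).
  rewrite -!octant_sumD -octant_sumB; apply: eq_octant_sum => a b c.
  by rewrite /out /psi !addSn !addnS !addSn !addn0 !mulrS !natrD; ring.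
have -> : octant_sum K (fun a b c => psi a.+1 a.+1 b c) = octant_sum K (fun a b c => psi a a b c).
  rewrite /octant_sum exchange_big [RHS]exchange_big; apply: eq_bigr => b _ /=.
  rewrite exchange_big [RHS]exchange_big; apply: eq_bigr => c _ /=.
  rewrite (sum_shift_ord _ (fun a => psi a a b c)) ///psi ?mulr0 ?mul0r//.
  by rewrite phiK ?mulr0// leq_maxl.
have -> : octant_sum K (fun a b c => psi b.+1 a b.+1 c) = octant_sum K (fun a b c => psi b a b c).
  apply: eq_bigr => a _ /=; rewrite exchange_big [RHS]exchange_big; apply: eq_bigr => c _ /=.
  rewrite (sum_shift_ord _ (fun b => psi b a b c)) ///psi ?mulr0 ?mul0r//.
  by rewrite phiK ?mulr0//; lia.
have -> : octant_sum K (fun a b c => psi c.+1 a b c.+1) = octant_sum K (fun a b c => psi c a b c).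
  apply: eq_bigr => a _; apply: eq_bigr => b _ /=.
  rewrite (sum_shift_ord _ (fun c => psi c a b c)) ///psi ?mulr0 ?mul0r//.
  by rewrite phiK ?mulr0//; lia.
rewrite -!octant_sumD -octant_sumB.
case: K phiK => [|K] phiK; first by rewrite /octant_sum big_ord0 phiK.
(* At level [n > 0] inflow and outflow both equal [2 / ((n+1)(n+2))]. At the origin the inflow is 0
   and the outflow is [3 * polya 1 = 1]. *)
have vanish a b c : (0 < a + b + c)%N ->
    out a b c - (psi a a b c + psi b a b c + psi c a b c) = 0.
  rewrite /out /psi; case: (a + b + c)%N (natrD R (a + b) c) (natrD R a b) => // n abc ab _.
  have -> : polya n.+2 * (n.+1 + 3)%:R = polya n.+1 * n.+1%:R.
    rewrite /polya addn3.
    by field; rewrite -!natrD -mulrS !pnatr_eq0.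
  by rewrite abc ab; ring.
rewrite /octant_sum (bigD1 ord0)//= [X in _ + X]big1 ?addr0; last first.
  move=> a a0; apply: big1 => b _; apply: big1 => c _; apply: vanish.
  by move: a0; rewrite -val_eqE/=; lia.
rewrite (bigD1 ord0)//= [X in _ + X]big1 ?addr0; last first.
  move=> b b0; apply: big1 => c _; apply: vanish.
  by move: b0; rewrite -val_eqE/=; lia.
rewrite (bigD1 ord0)//= [X in _ + X]big1 ?addr0; last first.
  by move=> c c0; apply: vanish; move: c0; rewrite -val_eqE/=; lia.
by rewrite /out /psi /polya !addn0 !mulr0 !mul0r; field.
Qed.


(** The outflow of a vertex at level [n] is [2 / ((n+1)(n+2))]. Its square is compared with a
    reciprocal product of four consecutive integers, which telescopes in each of the three
    coordinates. *)
Lemma polya_energy K :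
  octant_sum K (fun a b c => (polya (a + b + c).+1 * (a + b + c + 3)%:R) ^+ 2) <= 4.
Proof.
have pos n : 0 <= n%:R :> R by [].
pose r2 n : R := ((n%:R + 1) * (n%:R + 2))^-1.
pose r3 n : R := ((n%:R + 1) * (n%:R + 2) * (n%:R + 3))^-1.
pose r4 n : R := ((n%:R + 1) * (n%:R + 2) * (n%:R + 3) * (n%:R + 4))^-1.
(* The constant 24 is [4 * 6], from [(n+3)(n+4) <= 6(n+1)(n+2)], an equality at [n = 0]. The three
   telescoping sums contribute the factors 1/3, 1/2 and 1, leaving 4. *)
apply: (@le_trans _ _ (octant_sum K (fun a b c => 24 * r4 (a + b + c)%N))).
  apply: ler_octant_sum => a b c; move: (a + b + c)%N => n.
  have -> : polya n.+1 * (n + 3)%:R = 2 / ((n%:R + 1) * (n%:R + 2)).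
    rewrite /polya natrD -(natr1 n.+2) -(natr1 n.+1) -(natr1 n).
    by move: (pos n); set x := n%:R => x0; field; nonzero.
  rewrite /r4; move: (pos n); set x := n%:R => x0.
  rewrite expr_div_n ler_pdivrMr ?exprn_gt0 ?mulr_gt0//; try by lra.
  rewrite mulrAC ler_pdivlMr ?mulr_gt0//; try by lra.
  have x2 : 0 <= x ^+ 2 by rewrite exprn_ge0.
  have x3 : 0 <= x ^+ 3 by rewrite exprn_ge0.
  have x4 : 0 <= x ^+ 4 by rewrite exprn_ge0.
  by nra.
rewrite octant_sumZ (_ : 4 = 24 * 6^-1); last by field.
apply: ler_wpM2l => //.
have tele4 m : \sum_(c < K) r4 (m + c)%N <= 3^-1 * r3 m.
  rewrite -{2}[m]addn0.
  apply: (sum_telescope_le _ (fun c => 3^-1 * r3 (m + c)%N) (fun c => r4 (m + c)%N)) => c.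
    by rewrite /r3 mulr_ge0 ?invr_ge0 ?mulr_ge0 ?addr_ge0.
  rewrite addnS /r3 /r4 -(natr1 (m + c)%N).
  move: (m + c)%N => n; rewrite le_eqVlt; apply/orP; left; apply/eqP.
  by move: (pos n); set x := n%:R => x0; field; nonzero.
have tele3 m : \sum_(c < K) r3 (m + c)%N <= 2^-1 * r2 m.
  rewrite -{2}[m]addn0.
  apply: (sum_telescope_le _ (fun c => 2^-1 * r2 (m + c)%N) (fun c => r3 (m + c)%N)) => c.
    by rewrite /r2 mulr_ge0 ?invr_ge0 ?mulr_ge0 ?addr_ge0.
  rewrite addnS /r2 /r3 -(natr1 (m + c)%N).
  move: (m + c)%N => n; rewrite le_eqVlt; apply/orP; left; apply/eqP.
  by move: (pos n); set x := n%:R => x0; field; nonzero.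
have tele2 : \sum_(c < K) r2 c <= 1.
  rewrite -[leRHS]invr1 -[X in _ <= X^-1]add0r.
  apply: (sum_telescope_le _ (fun c => (c%:R + 1)^-1) r2) => n.
    by rewrite invr_ge0 addr_ge0.
  rewrite /r2 -(natr1 n) le_eqVlt; apply/orP; left; apply/eqP.
  by move: (pos n); set x := n%:R => x0; field; nonzero.
apply: (@le_trans _ _ (\sum_(a < K) \sum_(b < K) 3^-1 * r3 (a + b)%N)).
  by apply: ler_sum => a _; apply: ler_sum => b _; exact: tele4.
apply: (@le_trans _ _ (\sum_(a < K) 3^-1 * (2^-1 * r2 a))).
  by apply: ler_sum => a _; rewrite -mulr_sumr ler_wpM2l// tele3.
by rewrite -!mulr_sumr; lra.
Qed.

End polya_flow.

Lemma amgm_weighted (R : realFieldType) (mu x y : R) : 0 < mu ->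
  x * y <= mu / 2 * x ^+ 2 + y ^+ 2 / (2 * mu).
Proof.
move=> mu0; rewrite -subr_ge0.
have -> : mu / 2 * x ^+ 2 + y ^+ 2 / (2 * mu) - x * y = (mu * x - y) ^+ 2 / (2 * mu).
  by field; rewrite gt_eqF.
by rewrite divr_ge0 ?sqr_ge0// mulr_ge0// ltW.
Qed.

(** Pair the gradient of [phi] with the unit flow and apply [amgm_weighted] on each edge. The flow
    energy is at most 4, as the squares of the three outgoing flows add up to at most the square of
    their sum; this gives [mu / 2 * 4 = 2 * mu]. *)
Lemma octant_sobolev (R : realFieldType) K (phi : nat -> nat -> nat -> R) mu :
  0 < mu -> (forall a b c, (K <= maxn a (maxn b c))%N -> phi a b c = 0) ->
  phi 0%N 0%N 0%N <= 2 * mu + octant_sum R K (fun a b c =>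
    (phi a b c - phi a.+1 b c) ^+ 2 + (phi a b c - phi a b.+1 c) ^+ 2
    + (phi a b c - phi a b c.+1) ^+ 2) / (2 * mu).
Proof.
move=> mu0 phiK; rewrite -[leLHS](polya_flow _ K)//.
have energy_le := polya_energy R K.
apply: (@le_trans _ _ (mu / 2 * 4 + octant_sum R K (fun a b c =>
    (phi a b c - phi a.+1 b c) ^+ 2 + (phi a b c - phi a b.+1 c) ^+ 2
    + (phi a b c - phi a b c.+1) ^+ 2) / (2 * mu))); last by rewrite lerD2r; lra.
rewrite [X in _ + X]mulrC.
apply: (@le_trans _ _ (mu / 2 * octant_sum R K (fun a b c =>
    (polya R (a + b + c).+1 * (a + b + c + 3)%:R) ^+ 2) + (2 * mu)^-1 * octant_sum R K (fun a b c =>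
    (phi a b c - phi a.+1 b c) ^+ 2 + (phi a b c - phi a b.+1 c) ^+ 2
    + (phi a b c - phi a b c.+1) ^+ 2))); last first.
  by rewrite lerD2r ler_wpM2l// divr_ge0// ltW.
rewrite -!octant_sumZ -octant_sumD; apply: ler_octant_sum => a b c.
have -> : (a + b + c + 3)%:R = a.+1%:R + b.+1%:R + c.+1%:R :> R.
  by rewrite -!natrD; congr _%:R; lia.
move: (ler0n R a.+1) (ler0n R b.+1) (ler0n R c.+1); set p := polya _ _.
move: (a.+1%:R) (b.+1%:R) (c.+1%:R) => A B C A0 B0 C0.
move: (phi a b c - phi a.+1 b c) (phi a b c - phi a b.+1 c) (phi a b c - phi a b c.+1) => x y z.
have hx := amgm_weighted _ mu (p * A) x mu0.
have hy := amgm_weighted _ mu (p * B) y mu0.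
have hz := amgm_weighted _ mu (p * C) z mu0.
have hABC : mu / 2 * ((p * A) ^+ 2 + (p * B) ^+ 2 + (p * C) ^+ 2)
    <= mu / 2 * (p * (A + B + C)) ^+ 2.
  rewrite ler_wpM2l//; first by rewrite divr_ge0// ltW.
  rewrite !exprMn -!mulrDr ler_wpM2l ?sqr_ge0//.
  have := mulr_ge0 A0 B0; have := mulr_ge0 B0 C0; have := mulr_ge0 A0 C0; nra.
by move: hx hy hz hABC; move: (2 * mu)^-1 => r; lra.
Qed.

Section octant_embedding.
Variables (d : nat) (hd : (3 <= d)%N).

(** Coordinates from the fourth on are 0, the default value of [nth]. *)
Definition octant_point (a b c : nat) : 'rV[int]_d :=
  \row_(i < d) (nth 0%N [:: a; b; c] i)%:Z.

Let i0 : 'I_d := Ordinal (ltn_trans (isT : 0 < 2)%N hd).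
Let i1 : 'I_d := Ordinal (ltn_trans (isT : 1 < 2)%N hd).
Let i2 : 'I_d := Ordinal hd.

Lemma octant_point0 : octant_point 0 0 0 = 0.
Proof. by apply/rowP => -[[|[|[|n]]] hn]; rewrite !mxE /= ?nth_nil. Qed.

Lemma octant_pointSa a b c : octant_point a.+1 b c = octant_point a b c + delta_mx ord0 i0.
Proof.
by apply/rowP => -[[|[|[|n]]] hn]; rewrite !mxE /= ?nth_nil ?addr0 ?intS 1?addrC.
Qed.

Lemma octant_pointSb a b c : octant_point a b.+1 c = octant_point a b c + delta_mx ord0 i1.
Proof.
by apply/rowP => -[[|[|[|n]]] hn]; rewrite !mxE /= ?nth_nil ?addr0 ?intS 1?addrC.
Qed.

Lemma octant_pointSc a b c : octant_point a b c.+1 = octant_point a b c + delta_mx ord0 i2.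
Proof.
by apply/rowP => -[[|[|[|n]]] hn]; rewrite !mxE /= ?nth_nil ?addr0 ?intS 1?addrC.
Qed.

Lemma octant_point_inj : injective (fun p : nat * nat * nat => octant_point p.1.1 p.1.2 p.2).
Proof.
move=> [[a b] c] [[a' b'] c'] /= /rowP eq_abc.
have := eq_abc i0; rewrite !mxE /= => -[->].
have := eq_abc i1; rewrite !mxE /= => -[->].
by have := eq_abc i2; rewrite !mxE /= => -[->].
Qed.

Lemma supnorm_octant_point a b c : supnorm d (octant_point a b c) = maxn a (maxn b c).
Proof.
apply/eqP; rewrite eqn_leq; apply/andP; split.
  by apply/supnormP => -[[|[|[|n]]] hn]; rewrite mxE /= ?nth_nil ?absz_nat ?leq_max ?leqnn ?orbT.
have /supnormP h := leqnn (supnorm d (octant_point a b c)).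
by have := h i0; have := h i1; have := h i2; rewrite !mxE /= => ? ? ?; lia.
Qed.

(** Restrict [f] to the embedded octant; the edges of the lattice left out only add nonnegative
    terms on the right. *)
Lemma sobolev_origin (R : realFieldType) k (s : seq 'rV[int]_d) (f : 'rV[int]_d -> R) mu :
  uniq s -> {subset box d k.+1 <= s} -> (forall x, f x != 0 -> (supnorm d x <= k)%N) ->
  0 < mu ->
  f 0 <= 2 * mu + (\sum_(x <- s) \sum_(i < d) (f (x + delta_mx ord0 i) - f x) ^+ 2) / (2 * mu).
Proof.
move=> us ks fk mu0.
pose phi a b c := f (octant_point a b c).
have phiK a b c : (k.+1 <= maxn a (maxn b c))%N -> phi a b c = 0.
  rewrite -supnorm_octant_point ltnNge => nk.
  by apply/eqP; apply: contraNT nk => /fk.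
rewrite -octant_point0 -[f _]/(phi 0 0 0)%N.
apply: le_trans (octant_sobolev _ k.+1 phi mu mu0 phiK) _.
rewrite lerD2l ler_wpM2r//; first by rewrite invr_ge0 mulr_ge0// ltW.
pose D (x : 'rV[int]_d) := \sum_(i < d) (f (x + delta_mx ord0 i) - f x) ^+ 2.
have D0 x : 0 <= D x by apply: sumr_ge0 => i _; exact: sqr_ge0.
pose emb (p : 'I_k.+1 * 'I_k.+1 * 'I_k.+1) := octant_point p.1.1 p.1.2 p.2.
have emb_inj : injective emb.
  move=> [[a b] c] [[a' b'] c'] e.
  have := octant_point_inj (a : nat, b : nat, c : nat) (a' : nat, b' : nat, c' : nat) e.
  by case=> /val_inj -> /val_inj -> /val_inj ->.
apply: (@le_trans _ _ (\sum_(x <- map emb (enum {: 'I_k.+1 * 'I_k.+1 * 'I_k.+1})) D x)); last first.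
  apply: ler_sum_seq_subset => //; first by rewrite map_inj_uniq// enum_uniq.
  move=> x /mapP[[[a b] c] _ ->]; apply: ks; rewrite mem_box supnorm_octant_point/=.
  by have := ltn_ord a; have := ltn_ord b; have := ltn_ord c; lia.
rewrite big_map big_enum/=.
rewrite -(pair_bigA _ (fun ab c => D (emb (ab, c))))/=.
rewrite -(pair_bigA _ (fun a b => \sum_(c < k.+1) D (emb (a, b, c))))/=.
apply: ler_sum => a _; apply: ler_sum => b _; apply: ler_sum => c _.
rewrite /phi /D /emb/= octant_pointSa octant_pointSb octant_pointSc.
rewrite (bigD1 i0)//= (bigD1 i1)//= (bigD1 i2)//= !addrA.
rewrite -[X in X <= _]addr0 lerD//; last by apply: sumr_ge0 => i _; exact: sqr_ge0.
by rewrite le_eqVlt; apply/orP; left; apply/eqP; ring.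
Qed.

End octant_embedding.

(** * Potentials of small energy in dimension at most two *)

Section conductance_bounds.
Variables (R : realType) (d : nat) (ta tb : 'I_d -> int -> R) (c : R) (M : nat).
Hypotheses (c_gt0 : 0 < c) (c_ta : forall i y, c <= ta i y) (c_tb : forall i y, c <= tb i y).
Hypotheses (ta1 : forall i y, ta i y <= 1) (tb1 : forall i y, tb i y <= 1).
Variable alpha : 'I_d -> R.
Hypothesis far : forall i (y : int), (M < `|y|)%N -> ta i y = alpha i /\ tb i y = alpha i.

Lemma radial_weight_bounds i n :
  c ^+ M.+1 <= radial_weight R d ta tb i n <= c ^- M.+1.
Proof.
have c1 : c <= 1 by apply: le_trans (c_ta i 0) (ta1 i 0).
(* [minn n M.+1] counts the factors of index at most [M]. Each of these lies between [c] and [c^-1],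
   and every later factor is [alpha i / alpha i = 1]. *)
suff /andP[lb ub] : c ^+ minn n M.+1 <= radial_weight R d ta tb i n <= c^-1 ^+ minn n M.+1.
  rewrite (le_trans _ lb) ?(le_trans ub)//; last first.
    by rewrite ler_wiXn2l ?geq_minr// ltW.
  by rewrite -exprVn ler_weXn2l ?geq_minr// invf_ge1.
elim: n => [|n IH]; first by rewrite min0n !expr0 /radial_weight big_ord0 lexx.
rewrite /radial_weight big_ord_recr/= -/(radial_weight R d ta tb i n).
have [nM|Mn] := leqP n M.
  rewrite (minn_idPl _) ?ltnS// !exprSr.
  move: IH; rewrite (minn_idPl _) ?leqW// => /andP[lb ub].
  have tb0 : 0 < tb i n.+1%:Z by apply: lt_le_trans c_gt0 (c_tb _ _).
  have ta0 : 0 < ta i n%:Z by apply: lt_le_trans c_gt0 (c_ta _ _).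
  apply/andP; split; apply: ler_pM => //.
  - by rewrite exprn_ge0// ltW.
  - exact: ltW.
  - by rewrite ler_pdivlMr// (le_trans _ (c_ta i n%:Z))// ler_piMr// ltW.
  - by apply: le_trans lb; rewrite exprn_ge0// ltW.
  - by rewrite divr_ge0// ltW.
  - rewrite ler_pdivrMr// ler_pdivlMl// (le_trans _ (c_tb i n.+1%:Z))//.
    by rewrite ler_piMr// ltW.
rewrite (minn_idPr _) ?leqW//; move: IH; rewrite (minn_idPr _)//.
have [-> _] := far i n%:Z Mn; have [_ ->] := far i n.+1%:Z (ltnW Mn).
have [tan _] := far i n%:Z Mn.
by rewrite divff ?mulr1// -tan gt_eqF// (lt_le_trans c_gt0).
Qed.

Lemma conductance_bounds : exists2 kappa : R, 0 < kappa &
  forall i x, kappa <= conductance R d ta tb i x <= kappa^-1.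
Proof.
have cM : 0 < c ^+ M.+1 by rewrite exprn_gt0.
exists ((c ^+ M.+1) ^+ d * c) => [|i x]; first by rewrite mulr_gt0 ?exprn_gt0.
have c1 : c <= 1 by apply: le_trans (c_ta i 0) (ta1 i 0).
have const (r : R) : r ^+ d = \prod_(i < d) r by rewrite prodr_const card_ord.
have lb : (c ^+ M.+1) ^+ d <= reversing R d ta tb x.
  rewrite const; apply: ler_prod => j _.
  by rewrite ltW//; have /andP[] := radial_weight_bounds j `|x ord0 j|%N.
have ub : reversing R d ta tb x <= (c ^- M.+1) ^+ d.
  rewrite const; apply: ler_prod => j _.
  have /andP[lj ->] := radial_weight_bounds j `|x ord0 j|%N; rewrite andbT.
  by apply: le_trans lj; rewrite ltW.
rewrite /conductance; apply/andP; split.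
  by apply: ler_pM => //; rewrite ?exprn_ge0 ?ltW.
rewrite invfM -exprVn; apply: ler_pM => //.
- by apply: le_trans lb; rewrite exprn_ge0// ltW.
- by apply: le_trans (c_ta _ _); rewrite ltW.
- by apply: le_trans (ta1 _ _) _; rewrite invf_ge1.
Qed.

End conductance_bounds.

(** * Logarithmic potentials *)

Section logarithmic_potential.
Variables (R : realType) (d : nat).
Local Notation supnorm := (supnorm d).
Local Notation box := (box d).

Definition harmonic_sum (n : nat) : R := \sum_(j < n) j.+1%:R^-1.

(** A truncated radial logarithm: [harmonic_sum n - harmonic_sum k] at sup norm [k < n], and 0
    beyond. *)
Definition log_potential (n : nat) (x : 'rV[int]_d) : R :=
  \sum_(j < n) (supnorm x <= j)%N%:R / j.+1%:R.

Lemma harmonic_sum_ge1 n : 1 <= harmonic_sum n.+1.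
Proof.
by rewrite /harmonic_sum big_ord_recl/= invr1 lerDl sumr_ge0.
Qed.

Lemma harmonic_sum_unbounded A : exists n, A < harmonic_sum n.+1.
Proof.
apply: contrapT => /forallNP nA; apply: (@dvg_harmonic R).
have E n : series (@harmonic R) n = harmonic_sum n.
  by rewrite /series/= big_mkord.
apply: nondecreasing_is_cvgn.
  by apply/nondecreasing_seqP => n; rewrite /series/= big_nat_recr//= lerDl invr_ge0.
exists A => _ [n _ <-]; rewrite E.
have /negP := nA n; rewrite -leNgt; apply: le_trans.
by rewrite [leRHS]/harmonic_sum big_ord_recr/= lerDl invr_ge0.
Qed.

Lemma log_potential0 n : log_potential n 0 = harmonic_sum n.
Proof. by apply: eq_bigr => j _; rewrite supnorm0 mul1r. Qed.

Lemma log_potential_supp n x : log_potential n x != 0 -> (supnorm x < n)%N.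
Proof.
apply: contraNT; rewrite -leqNgt => nx; apply/eqP/big1 => j _.
by rewrite leqNgt (leq_trans (ltn_ord j) nx) mul0r.
Qed.

(** A step changes the sup norm by at most one. The worst case is a step inward from [l+1] to [l],
    which changes the potential by at most [1/(l+1) <= 2/(l+2)]; squaring gives the 4. *)
Lemma log_potential_lipschitz n x i :
  (log_potential n (x + delta_mx ord0 i) - log_potential n x) ^+ 2
  <= 4 / (supnorm x).+1%:R ^+ 2.
Proof.
pose h k : R := \sum_(j < n) (k <= j)%N%:R / j.+1%:R.
have h_diff k : 0 <= h k - h k.+1 <= k.+1%:R^-1.
  have -> : h k - h k.+1 = \sum_(j < n) (j == k :> nat)%:R / j.+1%:R.
    rewrite /h -sumrB; apply: eq_bigr => j _; rewrite -mulrBl; congr (_ / _).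
    by case: ltngtP => //; rewrite ?subrr ?subr0.
  rewrite sumr_ge0//=.
  have [kn|nk] := ltnP k n; last first.
    rewrite big1 ?invr_ge0// => j _.
    by rewrite ltn_eqF ?mul0r// (leq_trans (ltn_ord j) nk).
  rewrite (bigD1 (Ordinal kn))//= eqxx mul1r big1 ?addr0// => j.
  by rewrite -val_eqE/= => /negPf ->; rewrite mul0r.
have kl : (supnorm x <= (supnorm (x + delta_mx ord0 i)).+1)%N.
  by have := supnormB d (x + delta_mx ord0 i) i; rewrite addrK.
have lk := supnormD d x i.
rewrite -[log_potential n (x + _)]/(h (supnorm (x + delta_mx ord0 i))) -[log_potential n x]/(h (supnorm x)).
move: (supnorm x) (supnorm (x + _)) kl lk => k l kl lk.
have -> : 4 / k.+1%:R ^+ 2 = (2 / k.+1%:R) ^+ 2 :> R by rewrite expr_div_n; congr (_ / _); ring.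
rewrite -real_normK ?num_real// ler_sqr ?nnegrE//.
have k0 : 0 < k.+1%:R :> R by rewrite ltr0n.
have [lk1|lk1|->] := ltngtP l k; last by rewrite subrr normr0.
  have ekl : k = l.+1 by lia.
  have /andP[h0 h1] := h_diff l; rewrite ekl ger0_norm//; apply: le_trans h1 _.
  rewrite ler_pdivlMr ?ltr0n// mulrC ler_pdivrMr ?ltr0n// -natrM ler_nat; lia.
have -> : l = k.+1 by lia.
have /andP[h0 h1] := h_diff k; rewrite distrC ger0_norm//; apply: le_trans h1 _.
by rewrite ler_peMl// ler1n.
Qed.

(** Abel summation: a sum of [w (supnorm x)] over a box becomes a sum over radii [j] of the sizes of
    the smaller boxes. *)
Lemma layer_cake (w : nat -> R) (k K : nat) : (k <= K)%N ->
  w k = w K + \sum_(j < K) (k <= j)%N%:R * (w j - w j.+1).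
Proof.
elim: K => [|K IH]; first by rewrite leqn0 => /eqP ->; rewrite big_ord0 addr0.
rewrite leq_eqVlt => /predU1P[->|].
  by rewrite big1 ?addr0// => j _; rewrite leqNgt ltn_ord mul0r.
by rewrite ltnS big_ord_recr/= => kK; rewrite kK mul1r [LHS](IH kK); set S := \sum_(j < K) _; ring.
Qed.

(** For [d <= 2] a box of radius [j] has at most [(2j+1)^2] points, while [w j - w j.+1] has order
    [j^-3], so the layers sum to a multiple of the harmonic sum. The boundary term is at most
    [(2K+1)^2 / (K+1)^2 <= 4]. *)
Lemma sum_box_inv_sqr K : (d <= 2)%N ->
  \sum_(x <- box K) ((supnorm x).+1%:R ^+ 2)^-1 <= 4 + 8 * harmonic_sum K.
Proof.
move=> d2; pose w k : R := (k.+1%:R ^+ 2)^-1.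
have size_le k : (size (box k))%:R <= (2 * k%:R + 1) ^+ 2 :> R.
  rewrite -natrM natr1 -natrX ler_nat (leq_trans (size_box _ _))//.
  by rewrite leq_pexp2l.
have -> : \sum_(x <- box K) ((supnorm x).+1%:R ^+ 2)^-1 = \sum_(x <- box K)
    (w K + \sum_(j < K) (supnorm x <= j)%N%:R * (w j - w j.+1)).
  rewrite big_seq [RHS]big_seq; apply: eq_bigr => x; rewrite mem_box => xK.
  exact: (layer_cake w).
rewrite big_split/= lerD//.
  rewrite big_const_seq count_predT iter_addr_0 -[w K *+ _]mulr_natl.
  rewrite /w ler_pdivrMr ?exprn_gt0 ?ltr0n//; apply: le_trans (size_le _) _.
  by rewrite -natr1; have := ler0n R K; nra.
rewrite exchange_big/= /harmonic_sum mulr_sumr; apply: ler_sum => j _.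
rewrite -mulr_suml.
have -> : \sum_(x <- box K) (supnorm x <= j)%N%:R = (size [seq x <- box K | (supnorm x <= j)%N])%:R :> R.
  by rewrite size_filter -sum1_count natr_sum [RHS]big_mkcond; apply: eq_bigr => x _; case: ifP.
apply: (@le_trans _ _ ((2 * j%:R + 1) ^+ 2 * (w j - w j.+1))).
  rewrite ler_wpM2r//.
    rewrite subr_ge0 /w lef_pV2 ?posrE ?exprn_gt0 ?ltr0n//.
    by rewrite ler_sqr ?nnegrE// ler_nat.
  apply: le_trans (size_le j); rewrite ler_nat; apply: uniq_leq_size.
    by rewrite filter_uniq// box_uniq.
  by move=> x; rewrite mem_filter => /andP[xj _]; rewrite mem_box.
rewrite /w -(natr1 j.+1) -(natr1 j) -addrA; move: (ler0n R j); set x := j%:R => x0.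
have -> : ((x + 1) ^+ 2)^-1 - ((x + (1 + 1)) ^+ 2)^-1
    = (2 * x + 3) / ((x + 1) ^+ 2 * (x + 2) ^+ 2) by field; nonzero.
rewrite mulrA ler_pdivrMr ?mulr_gt0 ?exprn_gt0//; try lra.
have -> : 8 * (x + 1)^-1 * ((x + 1) ^+ 2 * (x + 2) ^+ 2) = 8 * (x + 1) * (x + 2) ^+ 2.
  by field; nonzero.
have := mulr_ge0 x0 x0; have := mulr_ge0 x0 (mulr_ge0 x0 x0); nra.
Qed.

End logarithmic_potential.

(** * Boundedness of the Green kernel *)

Section green_kernel.
Variables (R : realType) (d : nat) (ta tb : 'I_d -> int -> R).
Hypothesis ta_gt0 : forall i y, 0 < ta i y.
Hypothesis tb_gt0 : forall i y, 0 < tb i y.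
Hypothesis tab_sym : forall i y, ta i y = tb i (- y).

Local Notation Tr := (transition R d ta tb).
Local Notation inner := (weighted_inner R d ta tb).
Local Notation energy := (dirichlet_form R d ta tb).
Local Notation supnorm := (supnorm d).
Local Notation box := (box d).

Lemma transitionD f g x : Tr (fun y => f y + g y) x = Tr f x + Tr g x.
Proof.
rewrite /transition mulrDr addrACA -big_split/=; congr (_ + _).
by apply: eq_bigr => i _; ring.
Qed.

(** Self-adjointness of the transition operator: apply [green_identity] in both orders and use the
    symmetry of the Dirichlet form. *)
Lemma transition_sym k s f g : uniq s -> {subset box k.+1 <= s} ->
  (forall x, f x != 0 -> (supnorm x <= k)%N) -> (forall x, g x != 0 -> (supnorm x <= k)%N) ->
  inner s f (Tr g) = inner s (Tr f) g.
Proof.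
move=> us ks fk gk.
have innerB (u v w : 'rV[int]_d -> R) : inner s u (fun x => v x - w x) = inner s u v - inner s u w.
  by rewrite /weighted_inner -sumrB; apply: eq_bigr => x _; ring.
have fg := green_identity R d ta tb tb_gt0 tab_sym k s f g us ks fk.
have gf := green_identity R d ta tb tb_gt0 tab_sym k s g f us ks gk.
move: fg gf; rewrite !innerB dirichlet_formC.
rewrite (weighted_innerC R d ta tb s g) (weighted_innerC R d ta tb s g) => <- /addrI.
by move/oppr_inj.
Qed.

(** To be instantiated by the law of the walk at time [t] divided by the reversing measure;
    reversibility makes this density evolve by [transition]. *)
Variable rho : nat -> 'rV[int]_d -> R.
Hypothesis rho0 : forall x, rho 0%N x = (x == 0)%:R.
Hypothesis rhoS : forall t x, rho t.+1 x = Tr (rho t) x.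
Hypothesis rho_supp : forall t x, rho t x != 0 -> (supnorm x <= t)%N.
Hypothesis rho_ge0 : forall t x, 0 <= rho t x.

Definition green (N : nat) (x : 'rV[int]_d) : R := \sum_(t < N) rho t x.

Lemma green_supp N x : green N.+1 x != 0 -> (supnorm x <= N)%N.
Proof.
apply: contraNT; rewrite -ltnNge => Nx; apply/eqP/big1 => t _; apply/eqP.
apply: contraTT Nx => /rho_supp; rewrite -leqNgt => /leq_trans; apply.
by rewrite -ltnS.
Qed.

Lemma green_ge0 N x : 0 <= green N x.
Proof. exact: sumr_ge0. Qed.

Lemma green_poisson N x : green N x - Tr (green N) x = rho 0%N x - rho N x.
Proof.
elim: N => [|N IH].
  rewrite subrr /green big_ord0 /transition big1; last by move=> i _; rewrite !big_ord0 !mulr0 addr0.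
  by rewrite big_ord0 mulr0 addr0 subrr.
have E : green N.+1 = (fun y => green N y + rho N y).
  by apply/funext => y; rewrite /green big_ord_recr.
by rewrite E (transitionD (green N) (rho N)) rhoS; move: IH; lra.
Qed.

Lemma inner_rho0 s f : uniq s -> 0 \in s -> inner s f (rho 0%N) = f 0.
Proof.
move=> us s0; rewrite /weighted_inner; under eq_bigr do rewrite rho0.
by rewrite big_indicator// reversing0 mul1r.
Qed.

(** Self-adjointness moves the steps one by one from the second argument to the first, until a point
    mass at the origin remains. *)
Lemma inner_rho a b k s : uniq s -> {subset box k.+1 <= s} -> (a + b <= k)%N ->
  inner s (rho a) (rho b) = rho (a + b)%N 0.
Proof.
move=> us ks; elim: b a => [|b IH] a abk.
  by rewrite inner_rho0 ?addn0//; apply: ks; rewrite mem_box supnorm0.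
have -> : rho b.+1 = Tr (rho b) by apply/funext => x; rewrite rhoS.
rewrite (transition_sym k)//.
- have <- : rho a.+1 = Tr (rho a) by apply/funext => x; rewrite rhoS.
  by rewrite IH addSnnS.
- by move=> x /rho_supp; lia.
- by move=> x /rho_supp; lia.
Qed.

(** Pairing [green] with its Poisson equation gives its value at 0 minus an inner product of
    nonnegative functions. *)
Lemma energy_green_le N s : uniq s -> {subset box N.+2 <= s} ->
  energy s (green N.+1) (green N.+1) <= green N.+1 0.
Proof.
move=> us Ns.
rewrite -(green_identity R d ta tb tb_gt0 tab_sym N s)//; last first.
- exact: green_supp.
- by move=> x; rewrite mem_box => xN; apply: Ns; rewrite mem_box leqW.
under [weighted_inner _ _ _ _ _ _ _]eq_bigr do rewrite green_poisson mulrBr.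
rewrite sumrB -[X in X - _]/(inner s (green N.+1) (rho 0%N)) inner_rho0//; last first.
  by apply: Ns; rewrite mem_box supnorm0.
rewrite gerBl; apply: sumr_ge0 => x _.
by rewrite !mulr_ge0 ?green_ge0// ltW// reversing_gt0.
Qed.

Lemma energy_green f k N s : uniq s -> {subset box k.+1 <= s} ->
  (forall x, f x != 0 -> (supnorm x <= k)%N) ->
  energy s f (green N) = f 0 - inner s f (rho N).
Proof.
move=> us ks fk.
rewrite -(green_identity R d ta tb tb_gt0 tab_sym k s)//.
under [weighted_inner _ _ _ _ _ _ _]eq_bigr do rewrite green_poisson mulrBr.
rewrite sumrB -[X in X - _]/(inner s f (rho 0%N)) inner_rho0//.
by apply: ks; rewrite mem_box supnorm0.
Qed.

Variable kappa : R.
Hypothesis kappa_gt0 : 0 < kappa.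
Hypothesis kappa_le : forall i x, kappa <= conductance R d ta tb i x.

(** With [mu = kappa^-1], [sobolev_origin] reads [g 0 <= 2 / kappa + kappa * D / 2], and [kappa * D]
    is at most the energy, hence at most [g 0]. Absorbing [g 0 / 2] on the left gives the bound. *)
Lemma green_bounded : (3 <= d)%N -> forall N, green N 0 <= 4 / kappa.
Proof.
move=> hd; case=> [|N]; first by rewrite /green big_ord0 divr_ge0// ltW.
pose s := box N.+2.
have ub : energy s (green N.+1) (green N.+1) <= green N.+1 0.
  by apply: energy_green_le; rewrite ?box_uniq.
have kinv : 0 < kappa^-1 by rewrite invr_gt0.
have := sobolev_origin d hd R N s (green N.+1) kappa^-1 (box_uniq _ _) _ (green_supp N) kinv.
have le_energy : kappa * (\sum_(x <- s) \sum_(i < d)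
    (green N.+1 (x + delta_mx ord0 i) - green N.+1 x) ^+ 2)
    <= energy s (green N.+1) (green N.+1).
  rewrite mulr_sumr; apply: ler_sum => x _; rewrite mulr_sumr; apply: ler_sum => i _.
  by rewrite -mulrA -expr2 ler_wpM2r// sqr_ge0.
have sub : {subset box N.+1 <= s}.
  by move=> x; rewrite !mem_box => /leqW.
move=> /(_ sub); move: le_energy; set D := \sum_(x <- s) _ => le_energy.
rewrite invfM invrK => h.
have : D / 2 * kappa <= green N.+1 0 / 2 by lra.
rewrite -[4 / _]/(4 * kappa^-1); lra.
Qed.

Hypothesis kappa_ge : forall i x, conductance R d ta tb i x <= kappa^-1.

Lemma energy_amgm s f g mu : 0 < mu ->
  energy s f g <= mu / 2 * energy s g g + energy s f f / (2 * mu).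
Proof.
move=> mu0; rewrite /dirichlet_form mulr_sumr mulr_suml -big_split; apply: ler_sum => x _ /=.
rewrite mulr_sumr mulr_suml -big_split; apply: ler_sum => i _ /=.
have a0 := ltW (lt_le_trans kappa_gt0 (kappa_le i x)).
have := amgm_weighted _ mu (g (x + delta_mx ord0 i) - g x) (f (x + delta_mx ord0 i) - f x) mu0.
move=> /(ler_wpM2l a0); move: (2 * mu)^-1 => r; lra.
Qed.

Lemma inner_amgm s f g mu : 0 < mu ->
  inner s f g <= mu / 2 * inner s f f + inner s g g / (2 * mu).
Proof.
move=> mu0; rewrite /weighted_inner mulr_sumr mulr_suml -big_split; apply: ler_sum => x _ /=.
have a0 := ltW (reversing_gt0 R d ta tb ta_gt0 tb_gt0 x).
have := amgm_weighted _ mu (f x) (g x) mu0.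
move=> /(ler_wpM2l a0); move: (2 * mu)^-1 => r; lra.
Qed.

(** Each edge contributes at most [kappa^-1 * 4 / (supnorm x + 1)^2]. There are at most 2
    directions, and [4 + 8 * H <= 12 * H] because [H >= 1]; hence [96 = 2 * 4 * 12]. *)
Lemma energy_log_potential n s : (d <= 2)%N -> uniq s -> {subset box n.+1 <= s} ->
  energy s (log_potential R d n.+1) (log_potential R d n.+1) <= 96 / kappa * harmonic_sum R n.+1.
Proof.
move=> d2 us ns; set f := log_potential R d n.+1.
have -> : energy s f f = energy (box n.+1) f f.
  apply: eq_big_support; rewrite ?box_uniq// => x.
  have [/ns -> //|xn] := boolP (x \in box n.+1).
  rewrite big1 ?eqxx// => i _.
  have f0 y : (n.+1 <= supnorm y)%N -> f y = 0.
    by move=> ny; apply/eqP; apply: contraTT ny => /log_potential_supp; rewrite -ltnNge.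
  rewrite mem_box -ltnNge in xn.
  have := supnormB d (x + delta_mx ord0 i) i; rewrite addrK => xe.
  have -> : f (x + delta_mx ord0 i) = 0 by apply: f0; rewrite -ltnS (leq_trans xn).
  by rewrite (f0 x (ltnW xn)) subrr mulr0.
apply: (@le_trans _ _ (\sum_(x <- box n.+1) \sum_(i < d)
    kappa^-1 * (4 / (supnorm x).+1%:R ^+ 2))).
  apply: ler_sum => x _; apply: ler_sum => i _; rewrite -mulrA -expr2.
  have a0 := ltW (lt_le_trans kappa_gt0 (kappa_le i x)).
  by apply: ler_pM; rewrite ?sqr_ge0// log_potential_lipschitz.
under eq_bigr do rewrite sumr_const card_ord -[_ *+ d]mulr_natl mulrA mulrA.
rewrite -mulr_sumr.
have kinv : 0 < kappa^-1 by rewrite invr_gt0.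
have H1 := harmonic_sum_ge1 R n; have SB := sum_box_inv_sqr R d n.+1 d2.
have S0 : 0 <= \sum_(x <- box n.+1) ((supnorm x).+1%:R ^+ 2)^-1 :> R.
  by apply: sumr_ge0 => x _; rewrite invr_ge0 sqr_ge0.
move: SB S0; set S := \sum_(x <- _) _; set H := harmonic_sum _ _ => SB S0.
have dR : d%:R <= 2 :> R by rewrite ler_nat.
apply: (@le_trans _ _ (2 * kappa^-1 * 4 * S)).
  by rewrite ler_wpM2r// ler_wpM2r// ler_wpM2r// ltW.
rewrite -[96 / kappa]/(96 * kappa^-1).
have -> : 96 * kappa^-1 * H = 2 * kappa^-1 * 4 * (12 * H) by ring.
rewrite ler_wpM2l//; first by rewrite !mulr_ge0// ltW.
by move: H1 SB; rewrite -/H; lra.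
Qed.

(* Pair the logarithmic potential [f] with [green N]: by Poisson's equation the energy is
   [f 0 - <f, rho N>], and [|rho N|^2 = rho (2N) 0] is small for some [N] if [green]
   stays bounded at the origin. *)
Lemma green_unbounded : (d <= 2)%N -> forall G, exists N, G < green N 0.
Proof.
move=> d2 G; apply: contrapT => /forallNP nG.
have {}nG N : green N 0 <= G by rewrite leNgt; apply/negP.
have G0 : 0 <= G by apply: le_trans (nG 0%N); exact: green_ge0.
have kinv : 0 < kappa^-1 by rewrite invr_gt0.
(* With [mu = 192 / kappa] below, the constant 384 makes [mu / 2 * G] at most [H / 4]; the same [mu]
   brings the energy term of [f] down to [H / 4]. *)
have [n Hn] := harmonic_sum_unbounded R (384 * kappa^-1 * G).
pose f := log_potential R d n.+1; pose H := harmonic_sum R n.+1.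
have H1 : 1 <= H by exact: harmonic_sum_ge1.
pose B := inner (box n.+1) f f.
have f_supp x : f x != 0 -> (supnorm x <= n.+1)%N by move=> /log_potential_supp/ltnW.
have B0 : 0 <= B.
  by apply: sumr_ge0 => x _; rewrite -mulrA mulr_ge0 -?expr2 ?sqr_ge0// ltW// reversing_gt0.
(* Chosen so that [eps / 2 * B <= H / 4]; the [+ 1] keeps the denominator positive even if
   [B = 0]. *)
pose eps := H / (2 * (B + 1)).
have eps0 : 0 < eps by rewrite divr_gt0//; lra.
(* Otherwise the even-time terms alone would make [green] at the origin grow linearly. *)
have [N rN] : exists N, rho (N.+1 + N.+1)%N 0 < H * eps / 2.
  apply: contrapT => /forallNP nr.
  have {}nr N : H * eps / 2 <= rho (N.+1 + N.+1)%N 0 by rewrite leNgt; apply/negP.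
  have He : 0 < H * eps / 2 by rewrite divr_gt0// mulr_gt0//; lra.
  have lin m : m%:R * (H * eps / 2) <= green (m + m).+1 0.
    elim: m => [|m IH]; first by rewrite mul0r green_ge0.
    rewrite -natr1 mulrDl mul1r addnS addSn /green !big_ord_recr/= -/(green _ 0).
    have := nr m; rewrite addSn addnS; have := rho_ge0 (m + m).+1 0.
    move: IH; rewrite /green big_ord_recr/=; lra.
  have [m] : exists m : nat, G / (H * eps / 2) < m%:R.
    by exists (Num.trunc (G / (H * eps / 2))).+1; rewrite truncnS_gt.
  rewrite ltr_pdivrMr// => /lt_le_trans/(_ (lin m)).
  by rewrite ltNge nG.
pose K := (n.+1 + (N.+1 + N.+1)).+2; pose s := box K.
have us : uniq s by exact: box_uniq.
have sub k : (k <= K)%N -> {subset box k <= s}.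
  by move=> kK x; rewrite !mem_box => /leq_trans; apply.
have Een : energy s (green N.+1) (green N.+1) <= G.
  by apply: le_trans (nG N.+1); apply: energy_green_le => //; apply: sub; rewrite /K; clear -n N; lia.
have Ef : energy s f f <= 96 / kappa * H.
  by apply: energy_log_potential => //; apply: sub; rewrite /K; clear -n N; lia.
have Efg : energy s f (green N.+1) = H - inner s f (rho N.+1).
  rewrite (energy_green _ n.+1)//; last by apply: sub; rewrite /K; clear -n N; lia.
  by rewrite /f log_potential0.
have If : inner s f f = B.
  apply: eq_big_support; rewrite ?box_uniq// => x fx.
  have /f_supp xn : f x != 0 by apply: contraNneq fx => ->; rewrite mulr0.
  by rewrite !mem_box xn; apply: leq_trans xn _; rewrite /K; clear -n N; lia.
have Ir : inner s (rho N.+1) (rho N.+1) = rho (N.+1 + N.+1)%N 0.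
  by apply: (inner_rho _ _ (N.+1 + N.+1)) => //; apply: sub; rewrite /K; clear -n N; lia.
have mu0 : 0 < 192 * kappa^-1 by apply: mulr_gt0.
have := energy_amgm s f (green N.+1) _ mu0.
have := inner_amgm s f (rho N.+1) _ eps0.
rewrite Efg If Ir => inner_le energy_le.
(* Four terms of at most [H / 4], the last one strictly smaller, add up to a bound on [H] itself:
   the contradiction is [H < H]. *)
have t1 : 192 * kappa^-1 / 2 * energy s (green N.+1) (green N.+1) <= H / 4.
  apply: (@le_trans _ _ (192 * kappa^-1 / 2 * G)); first by apply: ler_wpM2l Een; rewrite divr_ge0 ?ltW.
  by move: Hn; rewrite -/H; lra.
have t2 : energy s f f / (2 * (192 * kappa^-1)) <= H / 4.
  rewrite ler_pdivrMr; last by apply: mulr_gt0.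
  apply: le_trans Ef _.
  by rewrite le_eqVlt; apply/orP; left; apply/eqP; field; rewrite gt_eqF.
have t3 : eps / 2 * B <= H / 4.
  rewrite /eps mulrAC [_ / _ * B]mulrAC ler_pdivrMr// ler_pdivrMr; last by lra.
  by nra.
have t4 : rho (N.+1 + N.+1)%N 0 / (2 * eps) < H / 4.
  rewrite ltr_pdivrMr; last by rewrite mulr_gt0.
  suff -> : H / 4 * (2 * eps) = H * eps / 2 by [].
  by move: (H) (eps) => h e; field.
lra.
Qed.

End green_kernel.

(** * The Markov property *)

Section countable_conditioning.
Variables (R : realType) (dT : measure_display) (T : measurableType dT).
Variables (P : probability T R) (C : countType) (X : T -> C).
Hypothesis mX : forall v, measurable [set w | X w = v].

Lemma countable_conditioning (E F : set T) (k : R) : measurable E -> measurable F -> 0 <= k ->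
  (forall v, P (E `&` [set w | X w = v]) = (k%:E * P (F `&` [set w | X w = v]))%E) ->
  P E = (k%:E * P F)%E.
Proof.
move=> mE mF k0 EF.
(* The fibres of [X] are indexed by [nat] through [pickle]; an index outside its range gives an
   empty level. *)
pose lev n := [set w | pickle (X w) = n].
have levP n : (exists v, lev n = [set w | X w = v]) \/ lev n = set0.
  have [[v vn]|nv] := pselect (exists v : C, pickle v = n).
    left; exists v; apply/seteqP; split=> w; rewrite /lev/=.
      by rewrite -vn => /(pcan_inj pickleK).
    by move=> ->.
  by right; apply/seteqP; split=> w //=; rewrite /lev/= => wn; apply: nv; exists (X w).
have mlev n : measurable (lev n) by case: (levP n) => [[v ->]//|->].
have split G : measurable G -> P G = (\sum_(n <oo) P (G `&` lev n))%E.
  move=> mG; rewrite -measure_semi_bigcup.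
  - rewrite -setI_bigcupr; congr (P _); apply/seteqP; split=> [w Gw|w []//].
    by split=> //; exists (pickle (X w)).
  - by move=> n; exact: measurableI.
  - by apply/trivIsetP => i j _ _ ij; apply/seteqP; split=> w //= -[[_ wi] [_ wj]];
      move/eqP: ij; rewrite -wi -wj.
  - by apply: bigcupT_measurable => n; exact: measurableI.
rewrite (split E mE) (split F mF) -nneseriesZl//.
apply: eq_eseriesr => n _; case: (levP n) => [[v ->]//|->].
by rewrite !setI0 measure0 mule0.
Qed.

(** Remove one fibre at a time. In the base case [countable_conditioning] with [k = 0] shows that an
    event null on every fibre is null. *)
Lemma finite_conditioning (s : seq C) (E : set T) : measurable E -> uniq s ->
  (forall v, v \notin s -> P (E `&` [set w | X w = v]) = 0%E) ->
  P E = (\sum_(v <- s) P (E `&` [set w | X w = v]))%E.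
Proof.
elim: s E => [|x s IH] E mE.
  move=> _ E0; rewrite big_nil (countable_conditioning E E 0)// ?mul0e// => v.
  by rewrite E0// mul0e.
move=> /= /andP[xs us] E0; rewrite big_cons.
have mEx : measurable (E `\` [set w | X w = x]) by exact: measurableD.
have off v : v != x -> (E `\` [set w | X w = x]) `&` [set w | X w = v] = E `&` [set w | X w = v].
  move=> vx; apply/seteqP; split=> w /=; first by move=> [[Ew _] wv].
  by move=> [Ew wv]; split=> //; split=> //; rewrite wv; apply/eqP.
have -> : P E = (P (E `&` [set w | X w = x]) + P (E `\` [set w | X w = x]))%E.
  by rewrite addeC; exact: measureDI.
congr (_ + _)%E.
rewrite (IH _ mEx us).
  rewrite big_seq [RHS]big_seq; apply: eq_bigr => v vs; rewrite off//.
  by apply: contraNneq xs => <-.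
move=> v vs; have [->|vx] := eqVneq v x.
  rewrite (_ : _ `&` _ = set0) ?measure0//.
  by apply/seteqP; split=> w //= [[_]].
by rewrite off// E0// inE negb_or vx.
Qed.

End countable_conditioning.

Section markov_chain.
Variables (R : realType) (d : nat) (ta tb : 'I_d -> int -> R).
Variables (dT : measure_display) (T : measurableType dT) (P : probability T R).
Variable S : nat -> T -> 'rV[int]_d.
Hypothesis mS : forall t x, measurable [set w | S t w = x].
Hypothesis S0 : forall w, S 0%N w = 0.
Hypothesis S_step : forall (t : nat) (h : nat -> 'rV[int]_d) (x : 'rV[int]_d),
  P [set w | (forall k, (k <= t)%N -> S k w = h k) /\ S t.+1 w = x]
  = (P [set w | forall k, (k <= t)%N -> S k w = h k] * (step_prob ta tb (h t) x)%:E)%E.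
Hypotheses (ta_ge0 : forall i y, 0 <= ta i y) (tb_ge0 : forall i y, 0 <= tb i y).
Hypothesis tab_le1 : forall x : 'rV[int]_d, \sum_(i < d) (ta i (x ord0 i) + tb i (x ord0 i)) <= 1.

Local Notation supnorm := (supnorm d).
Local Notation box := (box d).
Local Notation p := (step_prob ta tb).

Lemma step_prob_ge0 x y : 0 <= p x y.
Proof.
by rewrite addr_ge0// ?sumr_ge0// => [i _|]; rewrite ?addr_ge0 ?mulr_ge0// subr_ge0.
Qed.

Lemma step_prob_supp x y : p x y != 0 -> (supnorm y <= (supnorm x).+1)%N.
Proof.
apply: contraNT; rewrite -ltnNge => xy; apply/eqP; rewrite /step_prob.
have ne z : (supnorm z <= (supnorm x).+1)%N -> (y == z) = false.
  by move=> zx; apply: contraTF xy => /eqP ->; rewrite -leqNgt.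
rewrite ne ?leqW// mulr0 addr0 big1// => i _.
by rewrite !ne ?supnormD ?supnormB// !mulr0 addr0.
Qed.

(** The lower end [j] lets the past be forgotten one time at a time: [j = 0] is the full history,
    [j = t] only the present. *)
Definition cylinder (j t : nat) (h : nat -> 'rV[int]_d) : set T :=
  [set w | forall k, (j <= k <= t)%N -> S k w = h k].

Lemma measurable_cylinder j t h : measurable (cylinder j t h).
Proof.
have -> : cylinder j t h = \bigcap_k (if (j <= k <= t)%N then [set w | S k w = h k] else setT).
  apply/seteqP; split=> w /= hw k; first by move=> _; case: ifP => // /hw.
  by move=> jkt; have := hw k I; rewrite jkt.
by apply: bigcap_measurable; [exists 0%N|move=> k _; case: ifP].
Qed.

Lemma cylinder_diag t h : cylinder t t h = [set w | S t w = h t].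
Proof.
apply/seteqP; split=> w /=; first by apply; rewrite leqnn.
by move=> wt k; rewrite -eqn_leq => /eqP <-.
Qed.

Lemma cylinder_setI j t h x : (j < t)%N ->
  cylinder j.+1 t h `&` [set w | S j w = x]
  = cylinder j t (fun i => if i == j then x else h i).
Proof.
move=> jt; apply/seteqP; split=> w /=.
  move=> [wh wj] k /andP[]; rewrite leq_eqVlt => /predU1P[<- _|jk kt].
    by rewrite eqxx.
  by rewrite gtn_eqF//; apply: wh; rewrite jk.
move=> wh; split=> [k /andP[jk kt]|].
  by have := wh k; rewrite gtn_eqF// (ltnW jk) kt; apply.
by have := wh j; rewrite eqxx leqnn ltnW//; apply.
Qed.

(** The factor [k] is the same for all histories ending at [x], so the positions at times
    [0, ..., t - 1] can be summed out successively. *)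
Lemma markov_property t x (A : set T) (k : R) : measurable A -> 0 <= k ->
  (forall h, h t = x -> P (cylinder 0 t h `&` A) = (k%:E * P (cylinder 0 t h))%E) ->
  P ([set w | S t w = x] `&` A) = (k%:E * P [set w | S t w = x])%E.
Proof.
move=> mA k0 hA.
suff cylA j h : (j <= t)%N -> h t = x ->
    P (cylinder j t h `&` A) = (k%:E * P (cylinder j t h))%E.
  by have := cylA t (fun _ => x) (leqnn t) erefl; rewrite cylinder_diag.
elim: j h => [|j IH] h jt ht; first exact: hA.
apply: (countable_conditioning _ _ _ _ _ (S j)) => //.
- by apply: measurableI => //; exact: measurable_cylinder.
- exact: measurable_cylinder.
- by move=> v; rewrite setIAC cylinder_setI// IH ?(ltnW jt)// gtn_eqF.
Qed.

Definition occupation t x : R := fine (P [set w | S t w = x]).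

Lemma occupationE t x : P [set w | S t w = x] = (occupation t x)%:E.
Proof. by rewrite fineK// fin_num_measure. Qed.

Lemma occupation_ge0 t x : 0 <= occupation t x.
Proof. exact: fine_ge0. Qed.

Lemma occupation0 x : occupation 0 x = (x == 0)%:R.
Proof.
rewrite /occupation; have [->|x0] := eqVneq x 0.
  by rewrite (_ : [set w | _] = setT) ?probability_setT//; apply/seteqP; split=> w /= _; [|exact: S0].
rewrite (_ : [set w | _] = set0) ?measure0//; apply/seteqP; split=> w //=.
by rewrite S0 => x0'; rewrite x0' eqxx in x0.
Qed.

Lemma one_step t x y :
  P ([set w | S t w = x] `&` [set w | S t.+1 w = y]) = (p x y * occupation t x)%:E.
Proof.
rewrite EFinM -occupationE; apply: markov_property => //.
  exact: step_prob_ge0.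
by move=> h <-; rewrite muleC -S_step.
Qed.

Lemma occupation_supp t x : occupation t x != 0 -> (supnorm x <= t)%N.
Proof.
elim: t x => [|t IH] x.
  by rewrite occupation0 pnatr_eq0 eqb0 negbK => /eqP ->; rewrite supnorm0.
apply: contraNT; rewrite -ltnNge => tx; rewrite /occupation.
rewrite (finite_conditioning _ _ _ _ _ (S t) (mS t) [::])//.
  by rewrite big_nil.
move=> y _; rewrite setIC one_step.
have [->|/IH yt] := eqVneq (occupation t y) 0; first by rewrite mulr0.
have [->|/step_prob_supp xy] := eqVneq (p y x) 0; first by rewrite mul0r.
by move: tx; rewrite ltnNge (leq_trans xy).
Qed.

Lemma occupationS t y :
  occupation t.+1 y = \sum_(x <- box t) occupation t x * p x y.
Proof.
rewrite {1}/occupation (finite_conditioning _ _ _ _ _ (S t) (mS t) (box t))//.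
- under eq_bigr do rewrite setIC one_step mulrC.
  by rewrite sumEFin.
- exact: box_uniq.
move=> x xt; rewrite setIC one_step; have [->|/occupation_supp] := eqVneq (occupation t x) 0.
  by rewrite mulr0.
by rewrite -mem_box (negPf xt).
Qed.

Definition avoid (t n : nat) : set T :=
  [set w | forall k, (t < k <= t + n)%N -> S k w <> 0].

Lemma measurable_avoid t n : measurable (avoid t n).
Proof.
have -> : avoid t n = \bigcap_k (if (t < k <= t + n)%N then ~` [set w | S k w = 0] else setT).
  apply/seteqP; split=> w /= hw k; first by move=> _; case: ifP => // /hw.
  by move=> jkt; have := hw k I; rewrite jkt.
by apply: bigcap_measurable; [exists 0%N|move=> k _; case: ifP => // _; exact: measurableC].
Qed.

(** The probability, starting at [x], of not being at 0 at any of the times [1, ..., n], by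
    first-step recursion. The box contains every point reachable in one step. *)
Fixpoint avoid_prob (n : nat) (x : 'rV[int]_d) : R :=
  if n is n'.+1 then
    \sum_(y <- box (supnorm x).+1) p x y * ((y != 0)%:R * avoid_prob n' y)
  else 1.

Lemma avoid_prob_ge0 n x : 0 <= avoid_prob n x.
Proof.
elim: n x => [//|n IH] x /=; apply: sumr_ge0 => y _.
by rewrite !mulr_ge0// step_prob_ge0.
Qed.

(** Split according to the position [y] at time [t.+1]: [y = 0] contributes nothing, and otherwise
    the induction hypothesis applies to the history extended by [y]. *)
Lemma avoid_cylinder n t h :
  P (cylinder 0 t h `&` avoid t n) = ((avoid_prob n (h t))%:E * P (cylinder 0 t h))%E.
Proof.
elim: n t h => [|n IH] t h.
  rewrite mul1e (_ : avoid t 0 = setT) ?setIT//; apply/seteqP; split=> w //= _ k.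
  by rewrite addn0 ltnNge => /andP[/negP].
have mE : measurable (cylinder 0 t h `&` avoid t n.+1).
  by apply: measurableI; [exact: measurable_cylinder|exact: measurable_avoid].
have hS y : cylinder 0 t h `&` [set w | S t.+1 w = y]
    = cylinder 0 t.+1 (fun i => if i == t.+1 then y else h i).
  apply/seteqP; split=> w /=.
    move=> [wh wj] k /andP[_]; rewrite leq_eqVlt => /predU1P[->|kt]; first by rewrite eqxx.
    by rewrite ltn_eqF//; apply: wh.
  move=> wh; split=> [k kt|]; first by have := wh k; rewrite ltn_eqF ?ltnS// leqW//; apply.
  by have := wh t.+1; rewrite eqxx leqnn; apply.
have stepE y : P (cylinder 0 t h `&` [set w | S t.+1 w = y]) = ((p (h t) y)%:E * P (cylinder 0 t h))%E.
  by rewrite muleC -S_step.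
have E0 y : cylinder 0 t h `&` avoid t n.+1 `&` [set w | S t.+1 w = y]
    = if y == 0 then set0 else cylinder 0 t h `&` [set w | S t.+1 w = y] `&` avoid t.+1 n.
  have [->|y0] := eqVneq y 0.
    apply/seteqP; split=> w //= [[_ wa]]; apply: wa.
    by rewrite ltnSn addnS ltnS leq_addr.
  apply/seteqP; split=> w /= [[wh wa] wb]; (split; [split=> //|]) => //.
    by move=> k /andP[tk ktn]; apply: wa; rewrite (ltnW tk) addnS -addSn.
  move=> k /andP[]; rewrite leq_eqVlt => /predU1P[<- _|tk ktn].
    by rewrite wa; apply/eqP.
  by apply: wb; rewrite tk addSn -addnS.
have Ey y : P (cylinder 0 t h `&` avoid t n.+1 `&` [set w | S t.+1 w = y])
    = ((p (h t) y * ((y != 0)%:R * avoid_prob n y))%:E * P (cylinder 0 t h))%E.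
  rewrite E0; case: (eqVneq y 0) => [_|y0]; first by rewrite measure0 mul0r mulr0 mul0e.
  rewrite mul1r hS IH eqxx -hS stepE muleA -EFinM mulrC //.
rewrite (finite_conditioning _ _ _ _ _ (S t.+1) (mS t.+1) (box (supnorm (h t)).+1) _ mE)//.
- under eq_bigr do rewrite Ey.
  by rewrite -ge0_sume_distrl ?sumEFin// => y _; rewrite lee_fin !mulr_ge0 ?step_prob_ge0 ?avoid_prob_ge0.
- exact: box_uniq.
move=> y yb; rewrite Ey.
have [->|/step_prob_supp] := eqVneq (p (h t) y) 0; first by rewrite mul0r mul0e.
by rewrite -mem_box (negPf yb).
Qed.

Lemma avoid_from t x n :
  P ([set w | S t w = x] `&` avoid t n) = (avoid_prob n x * occupation t x)%:E.
Proof.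
rewrite EFinM -occupationE; apply: markov_property.
- exact: measurable_avoid.
- exact: avoid_prob_ge0.
- by move=> h <-; exact: avoid_cylinder.
Qed.

(* The events "S t = 0 with no return during the next N steps", t < N, are disjoint. *)
Lemma last_visit N : avoid_prob N 0 * \sum_(t < N) occupation t 0 <= 1.
Proof.
pose F t := [set w | S t w = 0] `&` avoid t N.
have mF t : measurable (F t) by apply: measurableI => //; exact: measurable_avoid.
rewrite -lee_fin mulr_sumr -sumEFin; under eq_bigr do rewrite -avoid_from -/(F _).
rewrite -(@measure_semi_additive_ord_I _ _ _ P F)//.
- by apply: probability_le1; exact: bigsetU_measurable.
- move=> i j /= iN jN [w [[wi ai] [wj aj]]].
  have [ij|ji|//] := ltngtP i j; exfalso.
    by apply: (ai j) => //; rewrite ij (leq_trans (ltnW jN))// leq_addl.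
  by apply: (aj i) => //; rewrite ji (leq_trans (ltnW iN))// leq_addl.
- exact: bigsetU_measurable.
Qed.

End markov_chain.

(** * Recurrence and transience *)

Section recurrence_criterion.
Variables (R : realType) (d : nat) (ta tb : 'I_d -> int -> R).
Variables (dT : measure_display) (T : measurableType dT) (P : probability T R).
Variable S : nat -> T -> 'rV[int]_d.
Hypothesis mS : forall t x, measurable [set w | S t w = x].
Hypothesis S0 : forall w, S 0%N w = 0.
Hypothesis S_step : forall (t : nat) (h : nat -> 'rV[int]_d) (x : 'rV[int]_d),
  P [set w | (forall k, (k <= t)%N -> S k w = h k) /\ S t.+1 w = x]
  = (P [set w | forall k, (k <= t)%N -> S k w = h k] * (step_prob ta tb (h t) x)%:E)%E.
Hypotheses (ta_gt0 : forall i y, 0 < ta i y) (tb_gt0 : forall i y, 0 < tb i y).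
Hypothesis tab_le1 : forall x : 'rV[int]_d, \sum_(i < d) (ta i (x ord0 i) + tb i (x ord0 i)) <= 1.
Hypothesis tab_sym : forall i y, ta i y = tb i (- y).

Let ta_ge0 i y : 0 <= ta i y. Proof. exact: ltW. Qed.
Let tb_ge0 i y : 0 <= tb i y. Proof. exact: ltW. Qed.

Local Notation supnorm := (supnorm d).
Local Notation box := (box d).
Local Notation occ := (occupation R d dT T P S).
Local Notation rev := (reversing R d ta tb).
Local Notation occS := (occupationS R d ta tb dT T P S mS S0 S_step ta_ge0 tb_ge0 tab_le1).
Local Notation occ_supp := (occupation_supp R d ta tb dT T P S mS S0 S_step ta_ge0 tb_ge0 tab_le1).

Definition density t x : R := occ t x / rev x.

Lemma density0 x : density 0 x = (x == 0)%:R.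
Proof.
rewrite /density occupation0//; case: eqVneq => [->|_]; last by rewrite mul0r.
by rewrite reversing0 invr1 mulr1.
Qed.

Lemma density_origin t : density t 0 = occ t 0.
Proof. by rewrite /density reversing0 invr1 mulr1. Qed.

Lemma density_ge0 t x : 0 <= density t x.
Proof. by rewrite divr_ge0 ?occupation_ge0// ltW// reversing_gt0. Qed.

Lemma density_supp t x : density t x != 0 -> (supnorm x <= t)%N.
Proof.
by move=> h; apply: occ_supp; apply: contraNneq h; rewrite /density => ->; rewrite mul0r.
Qed.

Lemma occupation_forward t y : occ t.+1 y =
  \sum_(i < d) (occ t (y - delta_mx ord0 i) * ta i ((y - delta_mx ord0 i) ord0 i)
              + occ t (y + delta_mx ord0 i) * tb i ((y + delta_mx ord0 i) ord0 i))
  + occ t y * (1 - \sum_(i < d) (ta i (y ord0 i) + tb i (y ord0 i))).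
Proof.
have ind (F : 'rV[int]_d -> R) z :
    \sum_(x <- box t) occ t x * F x * (x == z)%:R = occ t z * F z.
  rewrite (big_indicator R _ (fun x => occ t x * F x))// ?box_uniq// => h.
  by rewrite mem_box; apply: occ_supp; apply: contraNneq h => ->; rewrite mul0r.
rewrite occS /step_prob; under eq_bigr do rewrite mulrDr mulr_sumr.
rewrite big_split/= exchange_big/=; congr (_ + _); last first.
  rewrite -(ind (fun x => 1 - \sum_(i < d) (ta i (x ord0 i) + tb i (x ord0 i)))).
  by apply: eq_bigr => x _; rewrite [y == x]eq_sym mulrA.
apply: eq_bigr => i _.
rewrite -(ind (fun x => ta i (x ord0 i))) -(ind (fun x => tb i (x ord0 i))) -big_split/=.
apply: eq_bigr => x _; rewrite mulrDr !mulrA.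
have -> : (y == x + delta_mx ord0 i) = (x == y - delta_mx ord0 i) by rewrite -subr_eq eq_sym.
by have -> : (y == x - delta_mx ord0 i) = (x == y + delta_mx ord0 i) by rewrite eq_sym subr_eq.
Qed.

(** Detailed balance turns the forward equation for the law of the walk into the backward operator
    acting on its density. *)
Lemma densityS t y : density t.+1 y = transition R d ta tb (density t) y.
Proof.
have rev0 x : rev x != 0 by rewrite gt_eqF// reversing_gt0.
rewrite /density occupation_forward mulrDl mulr_suml /transition; congr (_ + _); last first.
  by rewrite mulrC mulrA mulrC mulrA mulrC; ring.
apply: eq_bigr => i _.
have Hm := conductanceB R d ta tb tb_gt0 tab_sym i y.
have Hp := reversing_balance R d ta tb tb_gt0 tab_sym i y.
have yi : (y + delta_mx ord0 i) ord0 i = y ord0 i + 1 by rewrite !mxE !eqxx.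
have -> : ta i (y ord0 i) = rev (y + delta_mx ord0 i) * tb i (y ord0 i + 1) / rev y.
  by rewrite -Hp mulrAC divff ?mul1r.
have -> : tb i (y ord0 i)
    = rev (y - delta_mx ord0 i) * ta i ((y - delta_mx ord0 i) ord0 i) / rev y.
  by rewrite -[X in X / _]/(conductance R d ta tb i (y - delta_mx ord0 i)) Hm mulrAC divff ?mul1r.
rewrite yi; field.
by rewrite !rev0.
Qed.

Lemma green_density N : green R d density N 0 = \sum_(t < N) occ t 0.
Proof. by apply: eq_bigr => t _; exact: density_origin. Qed.

Let A t := [set w | S t w = 0].

Lemma returns_lim_sup :
  [set w | forall n : nat, exists2 t : nat, (n <= t)%N & S t w = 0] = lim_sup_set A.
Proof.
apply/seteqP; split=> w /=.
  by move=> h n _; have [t nt St] := h n; exists t.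
by move=> h n; have [t /= nt St] := h n I; exists t.
Qed.

(** Borel-Cantelli: the return probabilities are summable, so infinitely many returns have
    probability 0. *)
Lemma transient_of_green_bounded (G : R) :
  (forall N, green R d density N 0 <= G) -> transient P S.
Proof.
move=> bound; rewrite /transient /recurrent returns_lim_sup lim_sup_set_cvg0//.
- by move/eqP; rewrite eq_sym onee_eq0.
- by move=> k; exact: mS.
apply: (@le_lt_trans _ _ G%:E); last by rewrite ltry.
apply: lime_le; first exact: is_cvg_nneseries.
apply: nearW => N; rewrite big_mkord.
rewrite (eq_bigr (fun t : 'I_N => (occ t 0)%:E)); last by move=> t _; exact: occupationE.
by rewrite sumEFin lee_fin -green_density.
Qed.

(** A path with finitely many returns has a last visit to the origin. By [last_visit], a last visit
    at any given time has probability 0 when [green] is unbounded. *)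
Lemma recurrent_of_green_unbounded :
  (forall G : R, exists N, G < green R d density N 0) -> recurrent P S.
Proof.
move=> unbounded.
have mA : measurable (lim_sup_set A).
  apply: bigcap_measurable; first by exists 0%N.
  by move=> n _; apply: bigcup_measurable => k _; exact: mS.
pose last t := A t `&` \bigcap_n avoid d dT T S t n.
have last_avoid t n : last t `<=` A t `&` avoid d dT T S t n.
  by move=> w [At h]; split=> //; exact: h.
have mlast t : measurable (last t).
  apply: measurableI; first exact: mS.
  by apply: bigcap_measurable; [exists 0%N|move=> n _; exact: measurable_avoid].
have last0 t : P (last t) = 0%E.
  apply/eqP; rewrite -measure_le0; apply/lee_addgt0Pr => e e0; rewrite add0e.
  (* Then [avoid_prob N 0 * e^-1 <= 1], so escape for [N] steps has probability at most [e]. *)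
  have [N GN] := unbounded e^-1.
  apply: (@le_trans _ _ (P (A t `&` avoid d dT T S t N))).
    rewrite le_measure ?inE//; apply: measurableI; [exact: mS|exact: measurable_avoid].
  rewrite (avoid_from R d ta tb)// lee_fin.
  have := last_visit R d ta tb dT T P S mS S_step ta_ge0 tb_ge0 tab_le1 N.
  rewrite -green_density => le1.
  have a0 := avoid_prob_ge0 R d ta tb ta_ge0 tb_ge0 tab_le1 N 0.
  have o1 : occ t 0 <= 1.
    rewrite -lee_fin -(occupationE R d dT T P S mS); exact: probability_le1.
  apply: (@le_trans _ _ (avoid_prob R d ta tb N 0)); first by rewrite ler_piMr.
  have einv : 0 < e^-1 by rewrite invr_gt0.
  rewrite -[e]invrK -div1r ler_pdivlMr//; apply: le_trans le1.
  by rewrite ler_wpM2l// ltW.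
have null : P (~` lim_sup_set A) = 0%E.
  apply/negligibleP; first exact: measurableC.
  apply: (@negligibleS _ _ _ _ (\bigcup_t last t)); last first.
    by apply: negligible_bigcup => t; apply/negligibleP; [exact: mlast|exact: last0].
  move=> w; rewrite -returns_lim_sup/= => /existsNP[n hn].
  have nret t : (n <= t)%N -> S t w <> 0 by move=> nt St; apply: hn; exists t.
  (* Time 0 is a visit, so the set of visit times is nonempty as well as bounded and has a
     maximum. *)
  have ex0 : exists t, S t w == 0 by exists 0%N; rewrite S0.
  have bound t : S t w == 0 -> (t <= n)%N.
    by move=> /eqP St; rewrite leqNgt; apply/negP => /ltnW/nret.
  case: (ex_maxnP ex0 bound) => t /eqP St tmax; exists t => //; split=> // m _ k /andP[tk _] Sk.
  by have := tmax k; rewrite Sk eqxx leqNgt tk => /(_ isT).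
rewrite /recurrent returns_lim_sup.
have := probability_setC P (measurableC mA).
by rewrite setCK null sube0.
Qed.

End recurrence_criterion.

Theorem theorem4p7 (R : realType) (d : nat) (hd : (1 <= d)%N)
  (alpha : 'I_d -> R) (halpha : forall i, 0 < alpha i)
  (hsum : 2 * \sum_(i < d) alpha i = 1)
  (c : R) (hc0 : 0 < c) (hc : forall i, c < alpha i)
  (M : nat)
  (ta tb : 'I_d -> int -> R)
  (hatc : forall i x, c <= ta i x) (hbtc : forall i x, c <= tb i x)
  (hab : forall i x, ta i x + tb i x <= 2 * alpha i)
  (hsym : forall i x, ta i x = tb i (- x))
  (hfar : forall i (x : int), (M < `|x|)%N -> ta i x = alpha i /\ tb i x = alpha i)
  (dT : measure_display) (T : measurableType dT) (P : probability T R)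
  (S : nat -> T -> 'rV[int]_d)
  (hmeas : forall t x, measurable [set w | S t w = x])
  (hS0 : forall w, S 0%N w = 0)
  (hstep : forall (t : nat) (h : nat -> 'rV[int]_d) (x : 'rV[int]_d),
     P [set w | (forall k, (k <= t)%N -> S k w = h k) /\ S t.+1 w = x]
     = (P [set w | forall k, (k <= t)%N -> S k w = h k]
        * (step_prob ta tb (h t) x)%:E)%E) :
  ((d <= 2)%N -> recurrent P S) /\ ((3 <= d)%N -> transient P S).
Proof.
have ta_gt0 i y : 0 < ta i y by apply: lt_le_trans hc0 _.
have tb_gt0 i y : 0 < tb i y by apply: lt_le_trans hc0 _.
have tab_le1 (x : 'rV[int]_d) : \sum_(i < d) (ta i (x ord0 i) + tb i (x ord0 i)) <= 1.
  by rewrite -[leRHS]hsum mulr_sumr; apply: ler_sum => i _.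
have alpha_le1 i : 2 * alpha i <= 1.
  rewrite -[leRHS]hsum ler_wpM2l// (bigD1 i)//= lerDl sumr_ge0// => j _; exact: ltW.
have ta_le1 i y : ta i y <= 1.
  by apply: le_trans (alpha_le1 i); apply: le_trans (hab i y); rewrite lerDl ltW.
have tb_le1 i y : tb i y <= 1.
  by apply: le_trans (alpha_le1 i); apply: le_trans (hab i y); rewrite lerDr ltW.
have [kappa kappa0 kappaP] := conductance_bounds R d ta tb c M hc0 hatc hbtc ta_le1 tb_le1 alpha hfar.
have kappa_le i x : kappa <= conductance R d ta tb i x by have /andP[] := kappaP i x.
have kappa_ge i x : conductance R d ta tb i x <= kappa^-1 by have /andP[] := kappaP i x.
pose rho := density R d ta tb dT T P S.
have rho0 x : rho 0%N x = (x == 0)%:R by apply: density0.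
have rhoS t x : rho t.+1 x = transition R d ta tb (rho t) x by apply: densityS.
have rho_supp t x : rho t x != 0 -> (supnorm d x <= t)%N by apply: density_supp.
have rho_ge0 t x : 0 <= rho t x by apply: density_ge0.
split=> [d2|d3].
  apply: (recurrent_of_green_unbounded R d ta tb) => //.
  exact: (green_unbounded R d ta tb ta_gt0 tb_gt0 hsym rho rho0 rhoS rho_supp rho_ge0 kappa).
apply: (transient_of_green_bounded R d ta tb dT T P S hmeas (4 / kappa)) => N.
exact: (green_bounded R d ta tb ta_gt0 tb_gt0 hsym rho rho0 rhoS rho_supp rho_ge0 kappa).
Qed.
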